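(* Let $\alpha$ be a composition. Then $$\mathcal S_\alpha=\sum_\beta d_{\alpha\beta}F_\beta,$$ summed over compositions $\beta$, where $d_{\alpha\beta}$ is the number of standard augmented fillings (SAFs) $T$ of shape $\gamma$, for some weak composition $\gamma$ with positive last part and $\alpha(\gamma)=\alpha$, such that $\beta(\mathcal D(T))=\beta$; equivalently, $d_{\alpha\beta}$ is the number of standard ComTs $T$ of shape $\alpha$ with $\beta(\mathcal D(T))=\beta$.
   Context: A weak composition is a finite sequence $\gamma=(\gamma_1,\dots,\gamma_n)$ of nonnegative integers; a composition has all parts positive; $|\gamma|=\sum\gamma_i$; $\alpha(\gamma)$ is obtained from $\gamma$ by deleting zero parts. For $S=\{i_1<\dots<i_{k-1}\}\subseteq\{1,\dots,N-1\}$, $\beta(S)=(i_1,i_2-i_1,\dots,N-i_{k-1})$. For a composition $\alpha=(\alpha_1,\dots,\alpha_k)$, $M_\alpha=\sum_{i_1<\dots<i_k}x_{i_1}^{\alpha_1}\cdots x_{i_k}^{\alpha_k}$ and $F_\alpha=\sum_\beta M_\beta$ over compositions $\beta$ such that $\alpha$ is obtained from $\beta$ by adding adjacent parts. SSAFs. The augmented diagram of $\gamma=(\gamma_1,\dots,\gamma_n)$ has cells $(i,j)$, $1\le i\le n$ (row, from top), $0\le j\le\gamma_i$ (column); column $0$ is the basement, cell $(i,0)$ containing $i$. An augmented filling assigns positive integers to non-basement cells. Cells $(i,j),(i',j')$ attack if $j=j'$, or $j=j'+1$ and $i>i'$; non-attacking means distinct attacking cells (basement included) have distinct entries. When comparing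 entries in a triple, of two equal entries the one appearing first when read top to bottom, right to left counts as smaller. Type A triple: $c=(i,k-1)$, $a=(i,k)$, $b=(j,k)$, $i<j$, $k\ge1$, $\gamma_i\ge\gamma_j$; inversion triple if in increasing order $a<c<b$, $c<b<a$ or $b<a<c$. Type B triple: $a=(i,k)$, $b=(j,k)$, $c=(j,k+1)$, $i<j$, $k\ge0$, $\gamma_j>\gamma_i$; inversion triple if in increasing order $a<c<b$, $c<b<a$ or $b<a<c$. An SSAF of shape $\gamma$ is a non-attacking augmented filling with rows (basement included) weakly decreasing left to right and all type A and B triples inversion triples; $x^F=\prod_i x_i^{w_i(F)}$ with $w_i(F)$ the number of non-basement cells containing $i$. An SAF of shape $\gamma$ is an SSAF with $x^F=x_1x_2\cdots x_{|\gamma|}$; its descent set $\mathcal D(F)$ is the set of $i\in\{1,\dots,|\gamma|-1\}$ such that the non-basement cell containing $i+1$ is not in a column strictly left of the non-basement cell containing $i$. $\mathcal A_\gamma=\sum_F x^F$ over SSAFs of shape $\gamma$; $\mathcal S_\alpha=\sum_\gamma \mathcal A_\gamma$ over weak compositions $\gamma$ with positive last part and $\alpha(\gamma)=\alpha$. ComTs. For a composition $\alpha=(\alpha_1,\dots,\alpha_\ell)$ with largest part $m$, a ComT of shape $\alpha$ is a filling of the left-justified diagram with $\alpha_i$ cells in row $i$ by positive integers with rows weakly decreasing left to right, leftmost column strictly increasing top to bottom, and such that, padding rows with $0$'s to an $\ell\times m$ array $\hat T$, for $1\le i<j\le\ell$, $2\le k\le m$: $\hat T(j,k)\ne0$ and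 $\hat T(j,k)\ge\hat T(i,k)$ imply $\hat T(j,k)>\hat T(i,k-1)$. It is standard if its $N$ cells contain $1,\dots,N$ once each; then $\mathcal D(T)$ is the set of $i\in\{1,\dots,N-1\}$ such that $i+1$ does not appear in a column strictly left of the column of $i$. *)

(* Defs.v *)
From mathcomp Require Import all_boot all_order all_algebra.
From mathcomp Require Import finmap multiset.
From mathcomp Require Import boolp classical_sets functions cardinality fsbigop.

Set Implicit Arguments.
Unset Strict Implicit.
Unset Printing Implicit Defensive.

Import GRing.Theory.

Local Open Scope classical_set_scope.
Local Open Scope ring_scope.
Local Open Scope nat_scope.

(** * Formal power series in x_1, x_2, ... *)

(** A monomial is the multiset of its variable indices (the multiplicity of [i]
    is the exponent of [x_i]); a series is its coefficient function. The index
    [0] is available in the type, but no series below involves [x_0]. *)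
Notation monomial := ({mset nat}%mset).

Definition fps := monomial -> int.

Definition mono (u : monomial) : fps := fun m => (m == u)%:R%R.

(** Infinite sums are taken coefficientwise. [\sum_(i \in A)] is [0] when the
    support is infinite; the [summable_*] lemmas at the end of this file show
    that every family summed below is summable. *)
Definition summable (I : choiceType) (A : set I) (f : I -> fps) : Prop :=
  forall m, finite_set [set i | A i /\ f i m <> 0%R].

Definition psum (I : choiceType) (A : set I) (f : I -> fps) : fps :=
  fun m => (\sum_(i \in A) f i m)%R.

(** * Compositions *)

(** Weak compositions are arbitrary elements of [seq nat]; the weight is [sumn]. *)
Definition is_composition (a : seq nat) : bool := all (leq 1) a.

Definition compress (g : seq nat) : seq nat := [seq x <- g | 0 < x].

(** For [g = [::]] the condition on the last part is vacuous, so that the empty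
    composition has exactly one expansion, [[::]]. *)
Definition expansion (a g : seq nat) : Prop := 0 < last 1 g /\ compress g = a.

(** beta(S) for the subset S of {1, ..., N-1} listed increasingly by [s]. *)
Definition beta (N : nat) (s : seq nat) : seq nat :=
  if N == 0 then [::] else pairmap (fun x y => y - x) 0 (rcons s N).

(** [a] is obtained from [b] by adding adjacent parts: [bs] cuts [b] into
    nonempty consecutive blocks whose sums are the parts of [a]. *)
Definition coarsening (a b : seq nat) : Prop :=
  exists bs : seq (seq nat),
    [/\ [::] \notin bs, flatten bs = b & map sumn bs = a].

(** * Monomial and fundamental quasisymmetric functions *)

Definition M_index (a : seq nat) : set (seq nat) :=
  [set i | [/\ size i = size a, all (leq 1) i & sorted ltn i]].

Definition M_term (a i : seq nat) : monomial :=
  \big[msetD/mset0]_(p <- zip i a) msetn p.2 p.1.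

Definition qsym_M (a : seq nat) : fps :=
  psum (M_index a) (fun i => mono (M_term a i)).

Definition F_index (a : seq nat) : set (seq nat) :=
  [set b | is_composition b /\ coarsening a b].

Definition qsym_F (a : seq nat) : fps := psum (F_index a) qsym_M.

(** * Fillings *)

(** A filling is the list of its rows from top to bottom, each row being the
    list of its (non-basement) entries from left to right; its shape is
    [seq.shape]. Rows and columns are numbered from 1 and column 0 is the
    basement. *)
Definition filling := seq (seq nat).

Definition part (g : seq nat) (i : nat) : nat := nth 0 g i.-1.

(** 1-based access, padding with 0. *)
Definition entry (T : filling) (i k : nat) : nat := nth 0 (nth [::] T i.-1) k.-1.

Definition content (T : filling) : monomial := seq_mset (flatten T).

Definition positive_entries (T : filling) : bool := all (all (leq 1)) T.

(** Column of the first cell containing [v] (the only one if [T] is standard). *)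
Definition column (T : filling) (v : nat) : nat :=
  (index v (nth [::] T (find (fun r => v \in r) T))).+1.

(** The set {1, ..., N-1} cut down to the descents, listed increasingly. *)
Definition descents (T : filling) : seq nat :=
  [seq i <- iota 1 (size (flatten T)).-1 | ~~ (column T i.+1 < column T i)].

Definition descent_composition (T : filling) : seq nat :=
  beta (size (flatten T)) (descents T).

(** * Semi-standard augmented fillings *)

Definition cell := (nat * nat)%type.

Definition in_aug_diagram (g : seq nat) (c : cell) : bool :=
  (0 < c.1 <= size g) && (c.2 <= part g c.1).

Definition aug_entry (T : filling) (c : cell) : nat :=
  if c.2 == 0 then c.1 else entry T c.1 c.2.

Definition attack (c d : cell) : bool :=
  (c.2 == d.2) || ((c.2 == d.2.+1) && (d.1 < c.1)).

Definition non_attacking (g : seq nat) (T : filling) : Prop :=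
  forall c d : cell, in_aug_diagram g c -> in_aug_diagram g d ->
    c != d -> attack c d -> aug_entry T c != aug_entry T d.

(** Columns from right to left, each column from top to bottom. *)
Definition read_before (c d : cell) : bool :=
  (d.2 < c.2) || ((c.2 == d.2) && (c.1 < d.1)).

Definition cell_lt (T : filling) (c d : cell) : bool :=
  (aug_entry T c < aug_entry T d)
  || ((aug_entry T c == aug_entry T d) && read_before c d).

Definition inversion_triple (T : filling) (a b c : cell) : bool :=
  [|| cell_lt T a c && cell_lt T c b,
      cell_lt T c b && cell_lt T b a
    | cell_lt T b a && cell_lt T a c].

Definition type_A_ok (g : seq nat) (T : filling) : Prop :=
  forall i j k : nat, 0 < i -> i < j -> 0 < k -> part g j <= part g i ->
    in_aug_diagram g (i, k) -> in_aug_diagram g (j, k) ->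
    inversion_triple T (i, k) (j, k) (i, k.-1).

Definition type_B_ok (g : seq nat) (T : filling) : Prop :=
  forall i j k : nat, 0 < i -> i < j -> part g i < part g j ->
    in_aug_diagram g (i, k) -> in_aug_diagram g (j, k.+1) ->
    inversion_triple T (i, k) (j, k) (j, k.+1).

Definition aug_rows_decreasing (g : seq nat) (T : filling) : Prop :=
  forall i k : nat, in_aug_diagram g (i, k.+1) ->
    aug_entry T (i, k.+1) <= aug_entry T (i, k).

Definition SSAF (g : seq nat) : set filling :=
  [set T | [/\ shape T = g, positive_entries T & non_attacking g T] /\
           [/\ aug_rows_decreasing g T, type_A_ok g T & type_B_ok g T]].

Definition SAF (g : seq nat) : set filling :=
  [set T | SSAF g T /\ content T = seq_mset (iota 1 (sumn g))].

Definition dem_atom (g : seq nat) : fps :=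
  psum (SSAF g) (fun T => mono (content T)).

Definition quasi_schur (a : seq nat) : fps := psum (expansion a) dem_atom.

(** * Composition tableaux *)

Definition ComT (a : seq nat) : set filling :=
  [set T | [/\ shape T = a, positive_entries T,
      all (sorted geq) T,
      (forall i j, 0 < i -> i < j -> j <= size a -> entry T i 1 < entry T j 1)
    & (forall i j k, 0 < i -> i < j -> j <= size a ->
         2 <= k <= \max_(x <- a) x ->
         entry T j k != 0 -> entry T i k <= entry T j k ->
         entry T i k.-1 < entry T j k)]].

Definition standard_ComT (a : seq nat) : set filling :=
  [set T | ComT a T /\ perm_eq (flatten T) (iota 1 (sumn a))].

(** * The coefficients *)

(** [#|` fset_set A|] is the cardinal of a finite set [A]; finiteness of the two
    sets counted is [finite_d_SAF_set] and [finite_d_ComT_set]. *)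
Definition d_SAF_set (a b : seq nat) : set filling :=
  [set T | (exists2 g, expansion a g & SAF g T) /\ descent_composition T = b].

Definition d_SAF (a b : seq nat) : nat := #|` fset_set (d_SAF_set a b)|%fset.

Definition d_ComT_set (a b : seq nat) : set filling :=
  [set T | standard_ComT a T /\ descent_composition T = b].

Definition d_ComT (a b : seq nat) : nat := #|` fset_set (d_ComT_set a b)|%fset.

Definition composition_set : set (seq nat) := [set b | is_composition b].

(** * Well-definedness of the sums and cardinals above *)

Lemma finite_bounded_seqs (T : eqType) (l : seq T) (n : nat) :
  finite_set [set s : seq T | size s <= n /\ {subset s <= l}].
Proof.
elim: n => [|n IHn].
  apply: (sub_finite_set _ (finite_set1 [::])) => s /= [+ _].
  by rewrite leqn0 => /nilP.
apply: (@sub_finite_set _ _ ([set [::]] `|`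
  [set x :: s | x in [set` l] & s in
     [set s : seq T | size s <= n /\ {subset s <= l}]])).
  case=> [|x s] /= [sn sl]; first by left.
  right; exists x; first exact/sl/mem_head.
  by exists s => //; split=> // y ys; apply: sl; rewrite in_cons ys orbT.
rewrite finite_setU; split; first exact: finite_set1.
by apply: finite_image2.
Qed.

Lemma mono_neq0 (u m : monomial) : mono u m <> 0%R -> m = u.
Proof. by rewrite /mono; case: eqP. Qed.

Lemma content_perm (T : filling) (m : monomial) :
  m = content T -> perm_eq (flatten T) m.
Proof. by move=> ->; rewrite perm_sym; apply: perm_eq_seq_mset. Qed.

Lemma finite_fillings (G : set (seq nat)) (l : seq nat) : finite_set G ->
  finite_set [set T : filling | G (shape T) /\ perm_eq (flatten T) l].
Proof.
move=> finG; apply: (sub_finite_set _ (finite_image2 (fun g s => reshape g s)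
  finG (finite_bounded_seqs l (size l)))) => T /= [GT Tl].
exists (shape T) => //; exists (flatten T); last exact: flattenK.
by split=> [|x]; rewrite ?(perm_size Tl) // (perm_mem Tl).
Qed.

Lemma mem_M_term (a i : seq nat) (x : nat) :
  is_composition a -> size i = size a -> x \in i -> x \in M_term a i.
Proof.
rewrite /M_term; elim: i a => [|y i IHi] [|p a] //= /andP[p0 ca] [ia].
rewrite in_cons big_cons in_msetD in_msetn p0 /= => /orP[->//|xi].
by rewrite IHi ?orbT.
Qed.

Lemma summable_M (a : seq nat) : is_composition a ->
  summable (M_index a) (fun i => mono (M_term a i)).
Proof.
move=> ca m; apply: (sub_finite_set _ (finite_bounded_seqs m (size a))).
move=> i [[ia _ _] /mono_neq0 ->]; split; first by rewrite ia.
by move=> x; apply: mem_M_term.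
Qed.

Lemma leq_sumn (x : nat) (s : seq nat) : x \in s -> x <= sumn s.
Proof.
elim: s => //= y s IHs; rewrite in_cons => /orP[/eqP->|/IHs]; first exact: leq_addr.
by move=> /leq_trans; apply; apply: leq_addl.
Qed.

Lemma size_composition (b : seq nat) : is_composition b -> size b <= sumn b.
Proof. by elim: b => //= x b IHb /andP[x0 /IHb]; rewrite -addn1 addnC; apply: leq_add. Qed.

Lemma finite_F_index (a : seq nat) : finite_set (F_index a).
Proof.
apply: (sub_finite_set _ (finite_bounded_seqs (iota 0 (sumn a).+1) (sumn a))).
move=> b [cb [bs [_ bsb bsa]]].
have eqs : sumn b = sumn a.
  by rewrite -bsb -bsa; elim: (bs) => //= s ss <-; rewrite sumn_cat.
split; first by rewrite -eqs size_composition.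
by move=> x xb; rewrite mem_iota /= ltnS -eqs leq_sumn.
Qed.

Lemma summable_F (a : seq nat) : summable (F_index a) qsym_M.
Proof. by move=> m; apply: sub_finite_set (finite_F_index a) => b []. Qed.

Lemma summable_dem_atom (g : seq nat) :
  summable (SSAF g) (fun T => mono (content T)).
Proof.
move=> m; apply: (sub_finite_set _ (finite_fillings m (finite_set1 g))).
by move=> T [[[Tg _ _] _] /mono_neq0 mT]; split=> //; apply: content_perm.
Qed.

(** The first column of an SSAF repeats the basement. *)
Lemma SSAF_col1 (g : seq nat) (T : filling) (i : nat) :
  SSAF g T -> 0 < i <= size g -> 0 < part g i -> entry T i 1 = i.
Proof.
move=> [[Tg posT naT] [decT _ _]] iP gi.
have i1 : in_aug_diagram g (i, 1) by rewrite /in_aug_diagram /= iP.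
have := decT i 0 i1; rewrite /aug_entry /= leq_eqVlt => /orP[/eqP //|lti].
move: iP i1 => /andP[i0 ig] i1.
have gt0 : 0 < entry T i 1.
  have iT : i.-1 < size T by rewrite -(size_map size) -/(shape T) Tg prednK.
  move/allP: posT => /(_ (nth [::] T i.-1)) /(_ (mem_nth _ iT)) /allP; apply.
  apply: mem_nth; rewrite -(nth_map _ 0 size) //.
  by rewrite -/(shape T) Tg.
have : aug_entry T (i, 1) != aug_entry T (entry T i 1, 0).
  apply: naT; rewrite ?/attack ?xpair_eqE ?andbF //=.
  by rewrite /in_aug_diagram /= gt0 (leq_trans (ltnW lti)).
by rewrite /aug_entry /= eqxx.
Qed.

Lemma finite_expansions (a l : seq nat) : finite_set
  [set g | expansion a g /\ exists2 T, SSAF g T & perm_eq (flatten T) l].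
Proof.
apply: (sub_finite_set _ (finite_bounded_seqs (0 :: a) (sumn l))).
move=> g [[lastg ga] [T gT Tl]]; split.
  have [->//|g0] := eqVneq g [::].
  have sg : 0 < size g by case: (g) g0.
  have gP : 0 < part g (size g).
    by rewrite /part nth_last; case: (g) g0 lastg.
  have sgP : 0 < size g <= size g by rewrite sg leqnn.
  have := SSAF_col1 gT sgP gP; rewrite /entry => <-.
  apply: leq_sumn; rewrite -(perm_mem Tl).
  case: gT => [[Tg _ _] _].
  have iT : (size g).-1 < size T by rewrite -(size_map size) -/(shape T) Tg prednK.
  apply/flattenP; exists (nth [::] T (size g).-1); first exact: mem_nth.
  by apply: mem_nth; rewrite -(nth_map _ 0 size) // -/(shape T) Tg.
move=> x xg; rewrite in_cons -ga mem_filter xg andbT lt0n.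
by case: eqP.
Qed.

Lemma summable_quasi_schur (a : seq nat) : summable (expansion a) dem_atom.
Proof.
move=> m; apply: (sub_finite_set _ (finite_expansions a m)) => g [ag gm].
split=> //; apply: contrapT => noT; apply: gm.
rewrite /dem_atom /psum fsbig1 // => T gT.
apply: contrapT => /mono_neq0/content_perm Tm; apply: noT.
by exists T.
Qed.

Lemma sumn_compress (g : seq nat) : sumn (compress g) = sumn g.
Proof. by elim: g => //= -[|x] g IHg //=; rewrite IHg. Qed.

Lemma finite_SAFs (a : seq nat) :
  finite_set [set T | exists2 g, expansion a g & SAF g T].
Proof.
apply: (sub_finite_set _ (finite_fillings (iota 1 (sumn a))
  (finite_expansions a (iota 1 (sumn a))))) => T [g ag [gT cT]].
have Tl : perm_eq (flatten T) (iota 1 (sumn a)).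
  by case: ag => _ <-; rewrite sumn_compress; apply/eq_seq_msetP.
have Tg : shape T = g by case: gT => -[].
split=> //=; rewrite Tg; split=> //; by exists T.
Qed.

Lemma finite_d_SAF_set (a b : seq nat) : finite_set (d_SAF_set a b).
Proof. by apply: sub_finite_set (finite_SAFs a) => T []. Qed.

Lemma finite_d_ComT_set (a b : seq nat) : finite_set (d_ComT_set a b).
Proof.
apply: (sub_finite_set _ (finite_fillings (iota 1 (sumn a)) (finite_set1 a))).
by move=> T [[[Ta _ _ _ _] ?] _].
Qed.

Lemma summable_expansion_F (a : seq nat) :
  summable composition_set (fun b => (qsym_F b *+ d_SAF a b)%R).
Proof.
move=> m; apply: (sub_finite_set _ (finite_image descent_composition (finite_SAFs a))).
move=> b [_ bm]; apply: contrapT => noT; apply: bm.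
suff -> : d_SAF a b = 0 by rewrite mulr0n.
rewrite /d_SAF (_ : d_SAF_set a b = set0) ?fset_set0 ?cardfs0 //.
by apply/seteqP; split=> // T [aT Tb]; apply: noT; exists T.
Qed.

(* Main.v *)
(** The first column of an SSAF repeats its basement, hence deleting the empty
    rows is a content- and column-preserving bijection from the SSAFs whose
    shape expands [a] onto the ComTs of shape [a]; its inverse puts each row
    back at the height given by its first entry. This identifies the two counts
    [d_SAF] and [d_ComT], and [quasi_schur a] with the content generating
    function of the ComTs.

    The entries of a column of a ComT are distinct, so its cells can be numbered
    by increasing entry, equal entries being numbered from right to left. This
    standardization [S] is again a ComT, and a tableau is determined by [S] and
    its content. A monomial [m] with sorted word [w] is the content of a ComT
    with standardization [S] if and only if [w] increases strictly at each
    descent of [S], i.e. if and only if the descent composition of [S] is a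
    coarsening of the exponents of [m]. Hence the ComTs with standardization [S]
    contribute the fundamental function of the descent composition of [S]. *)

Require Import Defs.
From mathcomp Require Import all_boot all_order all_algebra.
From mathcomp Require Import finmap multiset.
From mathcomp Require Import boolp classical_sets functions cardinality fsbigop.
From mathcomp Require Import zify.

Set Implicit Arguments.
Unset Strict Implicit.
Unset Printing Implicit Defensive.

Import Order.TTheory GRing.Theory.

Local Open Scope classical_set_scope.
Local Open Scope nat_scope.

(** * Sums of formal power series *)

Lemma eq_psum (I : choiceType) (A : set I) (f g : I -> fps) :
  (forall i, A i -> f i = g i) -> psum A f = psum A g.
Proof.
move=> eqfg; apply/funext => m; apply: eq_fsbigr => i; rewrite inE => Ai.
by rewrite eqfg.
Qed.

Lemma psum_set_bij (I J : choiceType) (A : set I) (B : set J) (h : I -> J)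
    (f : J -> fps) : set_bij A B h -> psum B f = psum A (f \o h).
Proof. by move=> hAB; apply/funext => m; apply: reindex_fsbig. Qed.

Lemma psum_const (I : choiceType) (A : set I) (f : fps) : finite_set A ->
  psum A (fun=> f) = (f *+ #|` fset_set A|%fset)%R.
Proof.
move=> finA; apply/funext => m; rewrite natmulfctE /psum fsbig_finite //=.
by rewrite big_const_seq count_predT iter_addr_0.
Qed.

Lemma fsum_fiber (I J : choiceType) (V : nmodType) (X : set I) (A : set J)
    (p : I -> J) (f : I -> V) : finite_set X -> X `<=` p @^-1` A ->
  (\sum_(j \in A) \sum_(x \in X `&` p @^-1` [set j]) f x =
   \sum_(x \in X) f x)%R.
Proof.
move=> finX XA; rewrite -(@fsbig_widen _ _ _ _ (p @` X)) /=; first last.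
- move=> j [_ nXj] /=; apply: fsbig1 => x [Xx pxj].
  by case: nXj; exists x.
- by move=> _ [x Xx <-]; apply: XA.
under eq_fsbigr do rewrite fsbig_mkcondr.
rewrite exchange_fsbig //; last exact: finite_image.
apply: eq_fsbigr => x; rewrite inE => Xx.
rewrite -(@fsbig_widen _ _ _ _ [set p x]) => [|_ ->|j [_ /= nj]]; last 2 first.
- by exists x.
- by rewrite ifF //; apply/negbTE/negP; rewrite inE => /esym.
by rewrite fsbig_set1 ifT // inE.
Qed.

Lemma psum_fiber (I J : choiceType) (X : set I) (A : set J) (p : I -> J)
    (f : I -> fps) : summable X f -> X `<=` p @^-1` A ->
  psum A (fun j => psum (X `&` p @^-1` [set j]) f) = psum X f.
Proof.
move=> sumX XA; apply/funext => m; rewrite /psum [RHS]fsbig_supp.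
rewrite -(@fsum_fiber _ _ _ _ A p); last 2 first.
- exact: sumX.
- by move=> x [/XA].
apply: eq_fsbigr => j _; rewrite [LHS]fsbig_supp; apply: eq_fsbigl.
by apply/seteqP; split=> x /= [[]].
Qed.

(** * Semi-standard augmented fillings by rows *)

Lemma geq_sorted_nthS (r : seq nat) (k : nat) :
  sorted geq r -> nth 0 r k.+1 <= nth 0 r k.
Proof.
move=> decr; have [kr|rk] := ltnP k.+1 (size r); first exact: (sortedP 0 decr).
by rewrite nth_default.
Qed.

(* The ComT condition on a row [r] lying above a row [r']: as entries are
   positive, the nonzero entries of a padded row are its cells. *)
Definition triple_rule (r r' : seq nat) : bool :=
  [forall k : 'I_(size r').-1,
     (nth 0 r k.+1 <= nth 0 r' k.+1) ==> (nth 0 r k < nth 0 r' k.+1)].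

Lemma triple_ruleP (r r' : seq nat) :
  reflect (forall k, k.+1 < size r' -> nth 0 r k.+1 <= nth 0 r' k.+1 ->
             nth 0 r k < nth 0 r' k.+1)
          (triple_rule r r').
Proof.
apply: (iffP forallP) => rule k; last first.
  by apply/implyP/rule; rewrite -ltn_predRL.
by rewrite -ltn_predRL => kr'; apply/implyP/(rule (Ordinal kr')).
Qed.

Lemma triple_rule_nilr (r : seq nat) : triple_rule r [::].
Proof. by apply/triple_ruleP. Qed.

Lemma triple_rule_nill (r : seq nat) : all (leq 1) r -> triple_rule [::] r.
Proof.
move=> /(all_nthP 0) posr; apply/triple_ruleP => k /posr.
by rewrite !nth_nil.
Qed.

Lemma triple_rule_cons (x y : nat) (r r' : seq nat) :
  (r' != [::] -> x < head 0 r') ->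
  triple_rule (x :: r) (y :: r') = triple_rule r r'.
Proof.
move=> ltx; apply/triple_ruleP/triple_ruleP => rule k; first exact: (rule k.+1).
by case: k => [|k]; [case: r' ltx {rule} => //= z r' ->|apply: rule].
Qed.

Section TwoRows.

Variables r r' : seq nat.
Hypothesis decr : sorted geq r.

Lemma triple_rule_neq_column (k : nat) : triple_rule r r' -> k.+1 < size r' ->
  nth 0 r k.+1 != nth 0 r' k.+1.
Proof.
move=> /triple_ruleP rule kr'; have := rule k kr'.
by have := geq_sorted_nthS k decr; lia.
Qed.

Lemma triple_rule_neq_diagonal (k : nat) : triple_rule r r' -> k.+1 < size r' ->
  nth 0 r k != nth 0 r' k.+1.
Proof.
move=> /triple_ruleP rule kr'; have := rule k kr'.
by have := geq_sorted_nthS k decr; lia.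
Qed.

(* Both conditions amount to r(k) < r'(k+1) for every column k of r; the
   first one is propagated from right to left and the second one from left
   to right. *)
Lemma triple_rule_longer : sorted geq r' -> all (leq 1) r' ->
  size r < size r' -> head 0 r < head 0 r' ->
  triple_rule r r' <-> (forall k, k < size r -> nth 0 r k <= nth 0 r' k ->
                          nth 0 r k < nth 0 r' k.+1).
Proof.
move=> decr' posr' ltrr' lt_head; split=> [/triple_ruleP rule k kr _|rule].
  have {kr} [d] : exists d, k + d.+1 = size r by exists (size r - k.+1); lia.
  elim: d k => [|d IHd] k kd; (apply: rule; first lia).
    by rewrite [nth 0 r _]nth_default //; lia.
  by rewrite ltnW // (leq_trans (IHd k.+1 _)) ?geq_sorted_nthS //; lia.
have ltS k : k < size r -> nth 0 r k < nth 0 r' k.+1.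
  elim: k => [|k IHk] kr; apply: rule => //; first by rewrite !nth0 ltnW.
  by rewrite ltnW // (leq_ltn_trans (geq_sorted_nthS k decr)) ?IHk // ltnW.
apply/triple_ruleP => k kr' _; have [/ltS //|rk] := ltnP k (size r).
by rewrite nth_default //; apply: (all_nthP 0 posr').
Qed.

End TwoRows.

Lemma cell_lt_left (T : filling) (i j k l : nat) : l < k ->
  cell_lt T (i, k) (j, l) = (aug_entry T (i, k) <= aug_entry T (j, l)).
Proof.
by move=> lk; rewrite /cell_lt /read_before /= lk andbT orbC -leq_eqVlt.
Qed.

Lemma cell_lt_right (T : filling) (i j k l : nat) : k < l ->
  cell_lt T (i, k) (j, l) = (aug_entry T (i, k) < aug_entry T (j, l)).
Proof. by move=> kl; rewrite /cell_lt /read_before /=; lia. Qed.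

Lemma cell_lt_up (T : filling) (i j k : nat) : i < j ->
  cell_lt T (j, k) (i, k) = (aug_entry T (j, k) < aug_entry T (i, k)).
Proof. by move=> ij; rewrite /cell_lt /read_before /=; lia. Qed.

Lemma inversion_triple_A (T : filling) (i j k : nat) : i < j ->
  aug_entry T (i, k.+1) <= aug_entry T (i, k) ->
  inversion_triple T (i, k.+1) (j, k.+1) (i, k) =
  (aug_entry T (i, k.+1) <= aug_entry T (j, k.+1)) ==>
  (aug_entry T (i, k) < aug_entry T (j, k.+1)).
Proof.
move=> ij deci; rewrite /inversion_triple cell_lt_up //.
rewrite !(cell_lt_left _ _ _ (ltnSn k)) (cell_lt_right _ _ _ (ltnSn k)).
by move: deci; lia.
Qed.

Lemma inversion_triple_B (T : filling) (i j k : nat) : i < j ->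
  aug_entry T (j, k.+1) <= aug_entry T (j, k) ->
  inversion_triple T (i, k) (j, k) (j, k.+1) =
  (aug_entry T (i, k) <= aug_entry T (j, k)) ==>
  (aug_entry T (i, k) < aug_entry T (j, k.+1)).
Proof.
move=> ij decj; rewrite /inversion_triple cell_lt_up //.
rewrite (cell_lt_left _ _ _ (ltnSn k)) (cell_lt_right _ _ _ (ltnSn k)).
by move: decj; lia.
Qed.

Local Notation row_at T i := (nth [::] T i).

Lemma part_shape (T : filling) (i : nat) :
  part (shape T) i.+1 = size (row_at T i).
Proof.
rewrite /part; have [iT|Ti] := ltnP i (size T); first by rewrite (nth_map [::]).
by rewrite !nth_default ?size_map.
Qed.

Lemma all_row_at (P : pred (seq nat)) (T : filling) (i : nat) :
  P [::] -> all P T -> P (row_at T i).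
Proof.
move=> P0 /(all_nthP [::]) PT; have [/PT //|Ti] := ltnP i (size T).
by rewrite nth_default.
Qed.

Definition aug_row (T : filling) (i : nat) : seq nat := i.+1 :: row_at T i.

Lemma aug_entryE (T : filling) (i k : nat) :
  aug_entry T (i.+1, k) = nth 0 (aug_row T i) k.
Proof. by case: k. Qed.

Lemma in_aug_diagramE (T : filling) (i k : nat) :
  in_aug_diagram (shape T) (i.+1, k) = (i < size T) && (k < size (aug_row T i)).
Proof. by rewrite /in_aug_diagram /= part_shape size_map. Qed.

Lemma aug_rows_decreasingP (T : filling) :
  aug_rows_decreasing (shape T) T <->
  (forall i, i < size T -> sorted geq (aug_row T i)).
Proof.
split=> dec.
  move=> i iT; apply/(sortedP 0) => k ki.
  by rewrite -!aug_entryE; apply: dec; rewrite in_aug_diagramE iT.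
move=> [|i] k //; rewrite in_aug_diagramE !aug_entryE => /andP[iT ki].
by have /(sortedP 0) := dec i iT; apply.
Qed.

Lemma type_A_okP (T : filling) : aug_rows_decreasing (shape T) T ->
  type_A_ok (shape T) T <->
  (forall i j, i < j < size T -> size (row_at T j) <= size (row_at T i) ->
     triple_rule (aug_row T i) (aug_row T j)).
Proof.
move=> dec; split=> [typeA i j ijT leji|rule].
  have [ij jT] := andP ijT; have iT := ltn_trans ij jT.
  apply/triple_ruleP => k kj.
  have ki : k.+1 < size (aug_row T i) by apply: leq_trans kj _.
  have diag_i : in_aug_diagram (shape T) (i.+1, k.+1).
    by rewrite in_aug_diagramE iT.
  have := typeA i.+1 j.+1 k.+1 isT ij isT.
  rewrite !part_shape => /(_ leji diag_i); rewrite in_aug_diagramE jT.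
  by rewrite inversion_triple_A ?dec // !aug_entryE => /(_ kj) /implyP.
move=> [|i] [|j] [|k] // _ ij _; rewrite !part_shape => leji diag_i.
rewrite in_aug_diagramE => /andP[jT kj].
rewrite inversion_triple_A ?dec // !aug_entryE; apply/implyP.
by apply: (triple_ruleP _ _ (rule i j _ leji)) => //; rewrite -ltnS ij.
Qed.

Lemma triple_rule_longer_aug_row (T : filling) (i j : nat) :
  positive_entries T -> aug_rows_decreasing (shape T) T ->
  i < j < size T -> size (row_at T i) < size (row_at T j) ->
  triple_rule (aug_row T i) (aug_row T j) <->
  (forall k, k < size (aug_row T i) ->
     nth 0 (aug_row T i) k <= nth 0 (aug_row T j) k ->
     nth 0 (aug_row T i) k < nth 0 (aug_row T j) k.+1).
Proof.
move=> posT /aug_rows_decreasingP dec /andP[ij jT] ltij.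
apply: triple_rule_longer; rewrite ?dec ?(ltn_trans ij) //.
exact: (all_row_at j isT posT).
Qed.

Lemma type_B_okP (T : filling) :
  positive_entries T -> aug_rows_decreasing (shape T) T ->
  type_B_ok (shape T) T <->
  (forall i j, i < j < size T -> size (row_at T i) < size (row_at T j) ->
     triple_rule (aug_row T i) (aug_row T j)).
Proof.
move=> posT dec; split=> [typeB i j ijT ltij|rule].
  apply/triple_rule_longer_aug_row => // k ki.
  have [ij jT] := andP ijT; have iT := ltn_trans ij jT.
  have diag_j : in_aug_diagram (shape T) (j.+1, k.+1).
    by rewrite in_aug_diagramE jT; apply: leq_ltn_trans ki _.
  have := typeB i.+1 j.+1 k isT ij; rewrite !part_shape in_aug_diagramE iT.
  move=> /(_ ltij ki diag_j).
  by rewrite inversion_triple_B ?dec // !aug_entryE => /implyP.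
move=> [|i] [|j] k // _ ij; rewrite !part_shape => ltij.
rewrite in_aug_diagramE => /andP[_ ki] diag_j; have := diag_j.
rewrite in_aug_diagramE => /andP[jT _].
rewrite inversion_triple_B ?dec // !aug_entryE; apply/implyP.
have ijT : i < j < size T by rewrite -ltnS ij.
have lt_ij := (triple_rule_longer_aug_row posT dec ijT ltij).1.
exact: lt_ij (rule i j ijT ltij) k ki.
Qed.

Lemma non_attacking_aug_rows (T : filling) :
  (forall i j k, i < j < size T -> k < size (aug_row T j) ->
     nth 0 (aug_row T i) k != nth 0 (aug_row T j) k) ->
  (forall i j k, i < j < size T -> k.+1 < size (aug_row T j) ->
     nth 0 (aug_row T i) k != nth 0 (aug_row T j) k.+1) ->
  non_attacking (shape T) T.
Proof.
move=> column diagonal [[|i] k] [[|j] l] //.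
rewrite !in_aug_diagramE !aug_entryE.
move=> /andP[iT ki] /andP[jT lj] neq /orP[/= /eqP kl|/= /andP[/eqP kl ji]].
  subst l; have [ij|ji|ij] := ltngtP i j; last by rewrite ij eqxx in neq.
    by apply: column; rewrite // ij.
  by rewrite eq_sym; apply: column; rewrite // ji.
by subst k; rewrite eq_sym; apply: diagonal; rewrite // -ltnS ji.
Qed.

(* [T] is preceded by [n] other rows. *)
Definition repeats_basement (n : nat) (T : filling) : Prop :=
  forall i, i < size T -> row_at T i != [::] ->
    head 0 (row_at T i) = (n + i).+1.

Lemma SSAF_repeats_basement (T : filling) :
  SSAF (shape T) T -> repeats_basement 0 T.
Proof.
move=> ssafT i iT; rewrite -size_eq0 -lt0n => rowi; rewrite -nth0.
by have := @SSAF_col1 _ T i.+1 ssafT; rewrite part_shape size_map iT; apply.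
Qed.

Lemma sorted_aug_rowP (T : filling) : repeats_basement 0 T ->
  all (sorted geq) T <-> (forall i, i < size T -> sorted geq (aug_row T i)).
Proof.
move=> basement.
have aug_rowE i : i < size T ->
    sorted geq (aug_row T i) = sorted geq (row_at T i).
  move=> /basement; rewrite /aug_row; case: (row_at T i) => //= x r -> //.
  by rewrite /geq /= leqnn.
split=> [decT i iT|dec]; first by rewrite aug_rowE // (all_row_at i isT decT).
by apply/(all_nthP [::]) => i iT; rewrite -aug_rowE // dec.
Qed.

Lemma triple_rule_aug_rowP (T : filling) : repeats_basement 0 T ->
  pairwise triple_rule T <->
  (forall i j, i < j < size T -> triple_rule (aug_row T i) (aug_row T j)).
Proof.
move=> basement.
have aug_rowE i j : i < j < size T ->
    triple_rule (aug_row T i) (aug_row T j) =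
    triple_rule (row_at T i) (row_at T j).
  by move=> /andP[ij jT]; apply: triple_rule_cons => /(basement j jT) ->.
split=> [/(pairwiseP [::]) rule i j ijT|rule].
  rewrite aug_rowE //; have [ij jT] := andP ijT.
  by apply: rule => //; apply: ltn_trans ij jT.
by apply/(pairwiseP [::]) => i j _ jT ij; rewrite -aug_rowE ?rule // ij.
Qed.

Lemma SSAF_aug_rowP (T : filling) :
  repeats_basement 0 T -> positive_entries T ->
  SSAF (shape T) T <->
  (forall i, i < size T -> sorted geq (aug_row T i)) /\
  (forall i j, i < j < size T -> triple_rule (aug_row T i) (aug_row T j)).
Proof.
move=> basement posT; split=> [[_ [dec typeA typeB]]|[decT rule]].
  split=> [|i j ijT]; first exact/aug_rows_decreasingP.
  have [ltij|leji] := ltnP (size (row_at T i)) (size (row_at T j)).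
    exact: (type_B_okP posT dec).1 typeB i j ijT ltij.
  exact: (type_A_okP dec).1 typeA i j ijT leji.
have dec := (aug_rows_decreasingP T).2 decT; split; split=> //.
- apply: non_attacking_aug_rows => i j k ijT; have [ij jT] := andP ijT.
    case: k => [_|k]; first by rewrite /= eqSS ltn_eqF.
    by apply: triple_rule_neq_column; rewrite ?decT ?rule // (ltn_trans ij).
  by apply: triple_rule_neq_diagonal; rewrite ?decT ?rule // (ltn_trans ij).
- by apply/(type_A_okP dec) => i j ijT _; apply: rule.
- by apply/(type_B_okP posT dec) => i j ijT _; apply: rule.
Qed.

Lemma SSAFP (T : filling) :
  SSAF (shape T) T <-> [/\ repeats_basement 0 T, positive_entries T,
                           all (sorted geq) T & pairwise triple_rule T].
Proof.
split=> [ssafT|[basement posT decT ruleT]].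
  have basement := SSAF_repeats_basement ssafT; have [[_ posT _] _] := ssafT.
  have [decT rule] := (SSAF_aug_rowP basement posT).1 ssafT.
  by split=> //; [apply/sorted_aug_rowP|apply/triple_rule_aug_rowP].
apply/SSAF_aug_rowP => //.
by split; [apply/sorted_aug_rowP|apply/triple_rule_aug_rowP].
Qed.

(** * Composition tableaux by rows *)

Definition first_column (T : filling) : seq nat := [seq head 0 r | r <- T].

Lemma entry_gt0 (T : filling) (i k : nat) : positive_entries T ->
  (0 < entry T i.+1 k.+1) = (k < size (row_at T i)).
Proof.
move=> /(all_row_at i isT)/(all_nthP 0) posi; apply/idP/idP => [|/posi //].
by rewrite (ltnNge k); apply: contraL => ki; rewrite /entry nth_default.
Qed.

Lemma ComTP (a : seq nat) (T : filling) :
  ComT a T <-> [/\ shape T = a, positive_entries T, all (sorted geq) T,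
                   sorted ltn (first_column T) & pairwise triple_rule T].
Proof.
rewrite (sorted_pairwise ltn_trans) pairwise_map.
split=> -[Ta posT decT firstT ruleT]; split=> //;
  have sizeT : size T = size a by rewrite -Ta size_map.
- apply/(pairwiseP [::]) => i j _; rewrite inE => jT ij.
  by have := firstT i.+1 j.+1 isT ij; rewrite -sizeT jT /= -!nth0; apply.
- apply/(pairwiseP [::]) => i j _; rewrite inE => jT ij.
  apply/triple_ruleP => k kj.
  have kmax : k.+2 <= \max_(x <- a) x.
    apply: leq_trans kj _; rewrite -Ta.
    by apply: leq_bigmax_seq => //; apply/map_f/mem_nth.
  apply: (ruleT i.+1 j.+1 k.+2 isT ij _ kmax); first by rewrite -sizeT.
  by rewrite -lt0n entry_gt0.
- move=> [|i] [|j] // _ ij ja; rewrite /entry /= !nth0.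
  apply: (pairwiseP [::] firstT); rewrite ?inE ?sizeT //.
  exact: leq_trans (ltnW ij) ja.
- move=> [|i] [|j] [|[|k]] // _ ij ja _; rewrite -lt0n entry_gt0 // => kj.
  have ruleij := pairwiseP [::] ruleT i j; apply: (triple_ruleP _ _ _ k) kj.
  apply: ruleij; rewrite ?inE ?sizeT //.
  exact: leq_trans (ltnW ij) ja.
Qed.

(* The conditions defining a ComT only compare a cell with a cell weakly to
   its right, by a strict inequality. *)
Lemma ComT_entry_ltn (a : seq nat) (T U : filling) : shape U = shape T ->
  (forall i j k l, k <= l -> (entry U i.+1 k.+1 < entry U j.+1 l.+1) =
                             (entry T i.+1 k.+1 < entry T j.+1 l.+1)) ->
  ComT a T -> ComT a U.
Proof.
move=> shapeU ltnU [Ta posT decT firstT ruleT].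
have size_rowU i : size (row_at U i) = size (row_at T i).
  by rewrite -!part_shape shapeU.
have sizeU : size U = size T.
  by rewrite -(size_map size) -/(shape U) shapeU size_map.
have posU : positive_entries U.
  apply/(all_nthP [::]) => i iU; apply/(all_nthP 0) => k ki.
  have := ltnU (size T) i k k (leqnn k); rewrite /entry /=.
  rewrite [row_at U (size T)]nth_default ?sizeU // [row_at T _]nth_default //.
  rewrite !nth_nil => ->; apply: (all_nthP 0 (all_row_at i isT posT)).
  by rewrite -size_rowU.
split; rewrite ?shapeU //.
- apply/(all_nthP [::]) => i iU; apply/(sortedP 0) => k ki.
  rewrite /geq /= leqNgt (ltnU i i k k.+1) // -leqNgt.
  exact: geq_sorted_nthS (all_row_at i isT decT).
- by move=> [|i] [|j] // _ ij ja; rewrite (ltnU i j 0 0) // firstT.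
- move=> [|i] [|j] [|[|k]] // _ ij ja kmax.
  rewrite -lt0n entry_gt0 // size_rowU -(entry_gt0 j k.+1 posT) lt0n => Tjk /=.
  rewrite leqNgt (ltnU j i) // -leqNgt (ltnU i j) //.
  exact: ruleT Tjk.
Qed.

(** * Deleting empty rows *)

Definition drop_empty (T : filling) : filling := [seq r <- T | r != [::]].

Lemma shape_drop_empty (T : filling) :
  shape (drop_empty T) = compress (shape T).
Proof. by elim: T => //= -[|x r] T //= ->. Qed.

Lemma flatten_drop_empty (T : filling) : flatten (drop_empty T) = flatten T.
Proof. by elim: T => //= -[|x r] T //= ->. Qed.

Lemma content_drop_empty (T : filling) : content (drop_empty T) = content T.
Proof. by rewrite /content flatten_drop_empty. Qed.

Lemma column_drop_empty (T : filling) (v : nat) :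
  column (drop_empty T) v = column T v.
Proof.
rewrite /column; congr _.+1; elim: T => //= -[|x r] T IHT //=.
by case: ifP.
Qed.

Lemma descent_composition_drop_empty (T : filling) :
  descent_composition (drop_empty T) = descent_composition T.
Proof.
rewrite /descent_composition /descents flatten_drop_empty; congr beta.
by apply: eq_filter => i; rewrite !column_drop_empty.
Qed.

Lemma all_drop_empty (P : pred (seq nat)) (T : filling) :
  P [::] -> all P (drop_empty T) = all P T.
Proof. by move=> P0; elim: T => //= -[|x r] T /= -> //; rewrite P0. Qed.

Lemma pairwise_drop_empty (R : rel (seq nat)) (T : filling) :
  (forall r, R r [::]) -> all (R [::]) T ->
  pairwise R (drop_empty T) = pairwise R T.
Proof.
move=> Rr0; elim: T => //= r T IHT /andP[R0r R0T]; rewrite -IHT //.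
by case: eqP => [->|_] /=; rewrite ?R0T // all_drop_empty.
Qed.

Lemma repeats_basement_cons (n : nat) (r : seq nat) (T : filling) :
  repeats_basement n (r :: T) <->
  (r != [::] -> head 0 r = n.+1) /\ repeats_basement n.+1 T.
Proof.
split=> [basement|[headr basement]].
  split=> [r0|i iT Ti]; first by rewrite (basement 0) ?addn0.
  by rewrite addSnnS; apply: (basement i.+1).
by move=> [|i] iT Ti; [rewrite addn0 headr|rewrite -addSnnS -basement].
Qed.

Lemma path_first_column_drop_empty (n : nat) (T : filling) :
  repeats_basement n T -> path ltn n (first_column (drop_empty T)).
Proof.
elim: T n => //= r T IHT n /repeats_basement_cons[headr /IHT path_n].
case: ifP => [/headr /= ->|_]; first by rewrite ltnSn.
exact: (path_le ltn_trans (ltnSn n) path_n).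
Qed.

Lemma SSAF_drop_empty (T : filling) : SSAF (shape T) T <->
  repeats_basement 0 T /\ ComT (compress (shape T)) (drop_empty T).
Proof.
have ruleE : positive_entries T ->
    pairwise triple_rule (drop_empty T) = pairwise triple_rule T.
  move=> posT; apply: pairwise_drop_empty; first exact: triple_rule_nilr.
  by apply: sub_all posT => r; apply: triple_rule_nill.
rewrite ComTP shape_drop_empty /positive_entries !all_drop_empty //.
split=> [/SSAFP[basement posT decT ruleT]|[basement [_ posT decT _ ruleT]]].
  split=> //; split; rewrite ?ruleE //.
  exact/(@path_sorted _ _ 0)/path_first_column_drop_empty.
by apply/SSAFP; split; rewrite -?ruleE.
Qed.

(* Each row of [U] is put at the height given by its first entry; [n] is the
   number of rows already placed. *)
Fixpoint insert_empty (n : nat) (U : filling) : filling :=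
  if U is r :: U' then
    nseq (head 0 r - n.+1) [::] ++ r :: insert_empty (head 0 r) U'
  else [::].

Lemma insert_emptyK (n : nat) (U : filling) :
  [::] \notin U -> drop_empty (insert_empty n U) = U.
Proof.
elim: U n => //= r U IHU n; rewrite in_cons negb_or eq_sym => /andP[r0 U0].
rewrite /drop_empty filter_cat /= r0 [X in _ ++ _ :: X]IHU //.
by elim: (_ - _).
Qed.

Lemma drop_emptyK (n : nat) (T : filling) : repeats_basement n T ->
  0 < last 1 (shape T) -> insert_empty n (drop_empty T) = T.
Proof.
elim: T n => //= r T IHT n /repeats_basement_cons[headr basement] lastT.
case: ifP => [/[dup] r0 /headr r1|/negbFE/eqP r0] /=.
  rewrite r1 subnn IHT //.
  by case: T {IHT basement} lastT.
subst r; have {}lastT : 0 < last 1 (shape T) /\ T != [::].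
  by case: T {IHT basement} lastT.
have := IHT n.+1 basement lastT.1.
have := path_first_column_drop_empty basement.
case: (drop_empty T) => [_ T0|r U /=].
  by rewrite -T0 in lastT; case: lastT.
by move=> /andP[nr _] <-; rewrite -(subnSK nr).
Qed.

Lemma last_shape_insert_empty (n x : nat) (U : filling) :
  [::] \notin U -> 0 < x -> 0 < last x (shape (insert_empty n U)).
Proof.
elim: U n x => //= r U IHU n x.
rewrite in_cons negb_or eq_sym => /andP[r0 U0] _.
by rewrite /shape map_cat last_cat /= IHU // lt0n size_eq0.
Qed.

Lemma repeats_basement_nseq (n d : nat) (T : filling) :
  repeats_basement (n + d) T -> repeats_basement n (nseq d [::] ++ T).
Proof.
elim: d n => [|d IHd] n; first by rewrite addn0.
by rewrite -addSnnS => /IHd basement; apply/repeats_basement_cons.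
Qed.

Lemma repeats_basement_insert_empty (n : nat) (U : filling) :
  path ltn n (first_column U) -> repeats_basement n (insert_empty n U).
Proof.
elim: U n => [|r U IHU] n; first by move=> _ [].
move=> /= /andP[nr /IHU basement].
apply/repeats_basement_nseq/repeats_basement_cons.
by have -> : (n + (head 0 r - n.+1)).+1 = head 0 r by lia.
Qed.

Definition SSAFs (a : seq nat) : set filling :=
  [set T | exists2 g, expansion a g & SSAF g T].

Lemma SSAF_shape (g : seq nat) (T : filling) : SSAF g T -> shape T = g.
Proof. by case=> -[]. Qed.

Lemma SSAFsP (a : seq nat) (T : filling) :
  SSAFs a T <-> expansion a (shape T) /\ SSAF (shape T) T.
Proof.
split=> [[g ag ssafT]|[aT ssafT]]; last by exists (shape T).
by rewrite (SSAF_shape ssafT).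
Qed.

Lemma nil_notin_composition_shape (T : filling) :
  is_composition (shape T) -> [::] \notin T.
Proof. by move=> /allP compT; apply/negP => /(map_f size)/compT. Qed.

Lemma path_first_column (T : filling) : is_composition (shape T) ->
  positive_entries T -> sorted ltn (first_column T) ->
  path ltn 0 (first_column T).
Proof.
move=> compT /allP posT sortedT; rewrite (path_sortedE ltn_trans) sortedT andbT.
apply/allP => _ /mapP[[|x r] rT ->]; last by case/andP: (posT _ rT).
by have := nil_notin_composition_shape compT; rewrite rT.
Qed.

Lemma set_bij_drop_empty (a : seq nat) : is_composition a ->
  set_bij (SSAFs a) (ComT a) drop_empty.
Proof.
move=> compa; split.
- by move=> T /SSAFsP[[_ <-] /SSAF_drop_empty[]].
- move=> T T'; rewrite !inE => /SSAFsP[[lastT _] /SSAF_repeats_basement baseT].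
  move=> /SSAFsP[[lastT' _] /SSAF_repeats_basement baseT'] eqTT'.
  by rewrite -(drop_emptyK baseT) // eqTT' drop_emptyK.
- move=> U comU; have [Ua posU _ firstU _] := (ComTP a U).1 comU.
  rewrite -Ua in compa comU *; have U0 := nil_notin_composition_shape compa.
  have dropU : drop_empty (insert_empty 0 U) = U by apply: insert_emptyK.
  exists (insert_empty 0 U) => //; apply/SSAFsP; split.
    by split; [apply: last_shape_insert_empty|rewrite -shape_drop_empty dropU].
  apply/SSAF_drop_empty; rewrite -shape_drop_empty dropU; split=> //.
  exact/repeats_basement_insert_empty/path_first_column.
Qed.

(** * Standardization *)

(* A cell is recorded as its entry and its column. Equal entries of a tableau
   lie in distinct columns and are standardized from right to left, so that no
   descent separates them: hence the dual order on the columns. *)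
Local Notation cell_key := (nat *l nat^d)%type.

Lemma cell_key_ltE (c d : cell_key) :
  (c < d)%O = (c.1 < d.1) || ((c.1 == d.1) && (d.2 < c.2)).
Proof.
by rewrite Order.ProdLexiOrder.ltEprodlexi ltEdual !leEnat ltEnat; lia.
Qed.

Definition row_keys (r : seq nat) : seq cell_key := zip r (iota 1 (size r)).

Definition cell_keys (T : filling) : seq cell_key :=
  flatten [seq row_keys r | r <- T].

Definition map_cells (f : cell_key -> nat) (T : filling) : filling :=
  [seq [seq f c | c <- row_keys r] | r <- T].

Lemma unzip1_row_keys (r : seq nat) : unzip1 (row_keys r) = r.
Proof. by rewrite unzip1_zip // size_iota. Qed.

Lemma size_row_keys (r : seq nat) : size (row_keys r) = size r.
Proof. by rewrite size_zip size_iota minnn. Qed.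

Lemma nth_row_keys (c : cell_key) (r : seq nat) (k : nat) : k < size r ->
  nth c (row_keys r) k = (nth 0 r k, k.+1).
Proof.
move=> kr; rewrite (set_nth_default (0, 0)) ?size_row_keys //.
by rewrite nth_zip ?size_iota // nth_iota.
Qed.

Lemma mem_row_keys (c : cell_key) (r : seq nat) : c \in row_keys r ->
  exists2 k, k < size r & c = (nth 0 r k, k.+1).
Proof.
move=> /(nthP c)[k]; rewrite size_row_keys => kr.
by rewrite nth_row_keys // => <-; exists k.
Qed.

Lemma row_keys_map (f : cell_key -> nat) (r : seq nat) :
  row_keys [seq f c | c <- row_keys r] =
  [seq (f c, c.2) | c <- row_keys r].
Proof.
apply: (@eq_from_nth _ (0, 0)) => [|k];
  rewrite !(size_row_keys, size_map) // => kr.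
rewrite nth_row_keys ?size_map ?size_row_keys //.
by rewrite !(nth_map (0, 0)) ?size_row_keys // nth_row_keys.
Qed.

Lemma unzip1_cell_keys (T : filling) : unzip1 (cell_keys T) = flatten T.
Proof.
rewrite /unzip1 map_flatten -map_comp; congr flatten.
by rewrite -[RHS]map_id; apply: eq_map => r; apply: unzip1_row_keys.
Qed.

Lemma size_cell_keys (T : filling) : size (cell_keys T) = size (flatten T).
Proof. by rewrite -unzip1_cell_keys size_map. Qed.

Lemma flatten_map_cells (f : cell_key -> nat) (T : filling) :
  flatten (map_cells f T) = [seq f c | c <- cell_keys T].
Proof. by rewrite map_flatten -map_comp. Qed.

Lemma cell_keys_map_cells (f : cell_key -> nat) (T : filling) :
  cell_keys (map_cells f T) = [seq (f c, c.2) | c <- cell_keys T].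
Proof.
rewrite /cell_keys map_flatten -!map_comp; congr flatten.
by apply: eq_map => r; apply: row_keys_map.
Qed.

Lemma map_cells_comp (f g : cell_key -> nat) (T : filling) :
  map_cells f (map_cells g T) = map_cells (fun c => f (g c, c.2)) T.
Proof.
rewrite /map_cells -map_comp; apply: eq_map => r /=.
by rewrite row_keys_map -map_comp.
Qed.

Lemma map_cells_id_in (f : cell_key -> nat) (T : filling) :
  {in cell_keys T, f =1 fst} -> map_cells f T = T.
Proof.
move=> fT; rewrite -[RHS]map_id; apply/eq_in_map => r rT.
rewrite -[RHS]unzip1_row_keys; apply/eq_in_map => c cr; apply: fT.
by apply/flattenP; exists (row_keys r) => //; apply: map_f.
Qed.

Lemma shape_map_cells (f : cell_key -> nat) (T : filling) :
  shape (map_cells f T) = shape T.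
Proof.
rewrite /shape -map_comp; apply: eq_map => r /=.
by rewrite size_map size_row_keys.
Qed.

Lemma size_row_map_cells (f : cell_key -> nat) (T : filling) (i : nat) :
  size (row_at (map_cells f T) i) = size (row_at T i).
Proof. by rewrite -!part_shape shape_map_cells. Qed.

Lemma ltn_row_size (T : filling) (i k : nat) :
  k < size (row_at T i) -> i < size T.
Proof. by have [//|Ti] := ltnP i (size T); rewrite nth_default. Qed.

Lemma entry_map_cells (f : cell_key -> nat) (T : filling) (i k : nat) :
  k < size (row_at T i) ->
  entry (map_cells f T) i.+1 k.+1 = f (entry T i.+1 k.+1, k.+1).
Proof.
move=> ki; rewrite /entry /= (nth_map [::]) ?(ltn_row_size ki) //.
by rewrite (nth_map (0, 0)) ?size_row_keys // nth_row_keys.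
Qed.

Lemma mem_cell_keys (T : filling) (i k : nat) : k < size (row_at T i) ->
  (entry T i.+1 k.+1, k.+1) \in cell_keys T.
Proof.
move=> ki; apply/flattenP; exists (row_keys (row_at T i)).
  exact/map_f/mem_nth/ltn_row_size/ki.
by rewrite -(nth_row_keys (0, 0)) // mem_nth // size_row_keys.
Qed.

Lemma column_cell_keys (T : filling) (v k : nat) :
  uniq (flatten T) -> (v, k) \in cell_keys T -> column T v = k.
Proof.
rewrite /column; elim: T => //= r T IHT; rewrite cat_uniq => /and3P[ur rT uT].
rewrite /cell_keys /= mem_cat => /orP[/mem_row_keys[l lr [-> ->]]|vT].
  by rewrite mem_nth //= index_uniq.
have /negPf -> /= : v \notin r; last exact: IHT.
apply: contra rT => vr; apply/hasP; exists v => //=.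
by rewrite -unzip1_cell_keys; apply/mapP; exists (v, k).
Qed.

Lemma cell_keysE (T : filling) : uniq (flatten T) ->
  cell_keys T = [seq (v, column T v) | v <- flatten T].
Proof.
move=> uT; rewrite -unzip1_cell_keys -map_comp -[LHS]map_id.
by apply/eq_in_map => -[v k] /(column_cell_keys uT) <-.
Qed.

Lemma ComT_uniq_cell_keys (a : seq nat) (T : filling) :
  ComT a T -> uniq (cell_keys T).
Proof.
move=> /ComTP[_ _]; rewrite (sorted_pairwise ltn_trans) pairwise_map.
elim: T => //= r T IHT /andP[decr decT] /andP[firstr firstT] /andP[ruler ruleT].
rewrite /cell_keys /= cat_uniq IHT // andbT.
have -> /= : uniq (row_keys r).
  apply: (@map_uniq _ _ snd).
  by rewrite -/unzip2 unzip2_zip ?size_iota ?iota_uniq.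
apply/hasPn => c /flattenP[_ /mapP[r' r'T ->] /mem_row_keys[k kr' ->]].
apply/negP => /mem_row_keys[l _ [eq_rr' kl]]; subst l.
have := allP firstr r' r'T; have := allP ruler r' r'T; rewrite /= -!nth0.
case: k kr' eq_rr' => [|k] kr' eq_rr' ruler'; first by rewrite eq_rr' ltnn.
by have := triple_rule_neq_column decr ruler' kr'; rewrite eq_rr' eqxx.
Qed.

Lemma ltn_entry_map_cells (f : cell_key -> nat) (T : filling) (i j k l : nat) :
  positive_entries T -> {in cell_keys T, forall c, 0 < f c} ->
  {in cell_keys T &, forall c d, (f c < f d) = (c < d)%O} -> k <= l ->
  (entry (map_cells f T) i.+1 k.+1 < entry (map_cells f T) j.+1 l.+1) =
  (entry T i.+1 k.+1 < entry T j.+1 l.+1).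
Proof.
move=> posT f_gt0 f_mono kl.
have [lj|jl] := ltnP l (size (row_at T j)); last first.
  by rewrite /entry /= !(@nth_default _ 0 _ l) ?size_row_map_cells // !ltn0.
rewrite (entry_map_cells f lj); have [ki|ik] := ltnP k (size (row_at T i)).
  by rewrite entry_map_cells // f_mono ?mem_cell_keys // cell_key_ltE /=; lia.
rewrite /entry /= !(@nth_default _ 0 _ k) ?size_row_map_cells //.
by rewrite f_gt0 ?mem_cell_keys // (entry_gt0 j l posT).
Qed.

Lemma ComT_map_cells (a : seq nat) (f : cell_key -> nat) (T : filling) :
  positive_entries T -> {in cell_keys T, forall c, 0 < f c} ->
  {in cell_keys T &, forall c d, (f c < f d) = (c < d)%O} ->
  ComT a (map_cells f T) <-> ComT a T.
Proof.
move=> posT f_gt0 f_mono.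
by split; apply: ComT_entry_ltn; rewrite ?shape_map_cells // => i j k l kl;
  rewrite ltn_entry_map_cells.
Qed.

Definition sorted_keys (T : filling) : seq cell_key := sort <=%O (cell_keys T).

Lemma size_sorted_keys (T : filling) : size (sorted_keys T) = size (flatten T).
Proof. by rewrite size_sort size_cell_keys. Qed.

Lemma mem_sorted_keys (T : filling) : sorted_keys T =i cell_keys T.
Proof. exact: mem_sort. Qed.

Lemma lt_sorted_sorted_keys (T : filling) :
  sorted <%O (sorted_keys T) = uniq (cell_keys T).
Proof. exact: sort_lt_sorted. Qed.

Definition rank (T : filling) (c : cell_key) : nat :=
  (index c (sorted_keys T)).+1.

Definition standardize (T : filling) : filling := map_cells (rank T) T.

Definition destandardize (w : seq nat) (S : filling) : filling :=
  map_cells (fun c => nth 0 w c.1.-1) S.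

Lemma ltn_rank (T : filling) : uniq (cell_keys T) ->
  {in cell_keys T &, forall c d, (rank T c < rank T d) = (c < d)%O}.
Proof.
move=> uT c d cT dT; have := uT; rewrite -lt_sorted_sorted_keys => sortedT.
rewrite -[in RHS](@nth_index _ c c (sorted_keys T)) ?mem_sorted_keys //.
rewrite -[in RHS](@nth_index _ c d (sorted_keys T)) ?mem_sorted_keys //.
by rewrite (lt_sorted_ltn_nth c sortedT) ?inE ?index_mem ?mem_sorted_keys.
Qed.

Lemma ComT_standardize (a : seq nat) (T : filling) :
  positive_entries T -> uniq (cell_keys T) ->
  ComT a (standardize T) <-> ComT a T.
Proof. by move=> posT uT; apply: ComT_map_cells => //; apply: ltn_rank. Qed.

Lemma map_index_uniq (T : eqType) (s : seq T) : uniq s ->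
  [seq index x s | x <- s] = iota 0 (size s).
Proof.
case: s => // x0 s us; apply: (@eq_from_nth _ 0);
  rewrite size_map ?size_iota // => i ilt.
by rewrite (nth_map x0) // index_uniq // nth_iota.
Qed.

Lemma flatten_standardize (T : filling) : uniq (cell_keys T) ->
  perm_eq (flatten (standardize T)) (iota 1 (size (flatten T))).
Proof.
move=> uT; rewrite flatten_map_cells -size_cell_keys -(size_sort <=%O).
rewrite -[1]/(1 + 0) iotaDl -map_index_uniq ?sort_uniq // -map_comp.
by apply: perm_map; rewrite perm_sym perm_sort.
Qed.

Lemma unzip1_sorted_keys (w : seq nat) (T : filling) : sorted leq w ->
  perm_eq (flatten T) w -> unzip1 (sorted_keys T) = w.
Proof.
move=> sortedw Tw; apply: (sorted_eq leq_trans anti_leq) => //.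
  apply: (homo_sorted (e := <=%O : rel cell_key)); last exact: sort_le_sorted.
  by move=> c d; rewrite le_eqVlt cell_key_ltE => /orP[/eqP->|] //=; lia.
apply: perm_trans Tw; rewrite -unzip1_cell_keys.
by apply: perm_map; rewrite perm_sort.
Qed.

Lemma standardizeK (w : seq nat) (T : filling) : sorted leq w ->
  perm_eq (flatten T) w -> destandardize w (standardize T) = T.
Proof.
move=> sortedw Tw; rewrite /destandardize map_cells_comp.
apply: map_cells_id_in => c cT /=; rewrite -(unzip1_sorted_keys sortedw Tw).
by rewrite (nth_map (0, 0)) ?index_mem ?nth_index ?mem_sorted_keys.
Qed.

Definition increases_at (w s : seq nat) : bool :=
  all (fun p => nth 0 w p.-1 < nth 0 w p) s.

Lemma column_standardize (T : filling) (p : nat) : uniq (cell_keys T) ->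
  p < size (flatten T) ->
  column (standardize T) p.+1 = (nth ((0, 0) : cell_key) (sorted_keys T) p).2.
Proof.
move=> uT pT; apply: column_cell_keys.
  by rewrite (perm_uniq (flatten_standardize uT)) iota_uniq.
rewrite cell_keys_map_cells; apply/mapP.
exists (nth ((0, 0) : cell_key) (sorted_keys T) p).
  by rewrite -mem_sorted_keys mem_nth ?size_sorted_keys.
by rewrite /rank index_uniq ?sort_uniq ?size_sorted_keys.
Qed.

Lemma mem_descents (T : filling) (p : nat) :
  (p \in descents T) =
  (0 < p < size (flatten T)) && ~~ (column T p.+1 < column T p).
Proof. by rewrite mem_filter mem_iota andbC; congr (_ && _); lia. Qed.

Lemma increases_at_descents_standardize (w : seq nat) (T : filling) :
  uniq (cell_keys T) -> sorted leq w -> perm_eq (flatten T) w ->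
  increases_at w (descents (standardize T)).
Proof.
move=> uT sortedw Tw; apply/allP => -[|p]; rewrite mem_descents //.
rewrite (perm_size (flatten_standardize uT)) size_iota => /andP[pT].
rewrite !column_standardize ?(ltnW pT) // => desc.
have := uT; rewrite -lt_sorted_sorted_keys => /(sortedP (0, 0)) /(_ p).
rewrite size_sorted_keys => /(_ pT); rewrite -(unzip1_sorted_keys sortedw Tw).
rewrite !(nth_map (0, 0)) ?size_sorted_keys ?(ltnW pT) //.
by rewrite cell_key_ltE (negPf desc) andbF orbF.
Qed.

Section Destandardize.

Variables (w : seq nat) (S : filling).
Hypothesis sortedw : sorted leq w.
Hypothesis Sw : perm_eq (flatten S) (iota 1 (size w)).
Hypothesis incrw : increases_at w (descents S).

Let uniqS : uniq (flatten S).
Proof. by rewrite (perm_uniq Sw) iota_uniq. Qed.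

Lemma flatten_destandardize : perm_eq (flatten (destandardize w S)) w.
Proof.
rewrite flatten_map_cells (map_comp (fun p => nth 0 w p.-1) fst).
rewrite -/(unzip1 _) unzip1_cell_keys.
apply: (perm_trans (perm_map _ Sw)); rewrite -[1]/(1 + 0) iotaDl -map_comp.
by rewrite [map _ _](mkseq_nth 0 w).
Qed.

Let relabelled : seq cell_key :=
  [seq (nth 0 w p.-1, column S p) | p <- iota 1 (size w)].

Let nth_relabelled (p : nat) : p < size w ->
  nth (0, 0) relabelled p = (nth 0 w p, column S p.+1).
Proof. by move=> pw; rewrite (nth_map 0) ?size_iota // nth_iota. Qed.

Let sorted_relabelled : sorted <%O relabelled.
Proof.
apply/(sortedP (0, 0)) => p; rewrite size_map size_iota => pw.
rewrite !nth_relabelled ?(ltnW pw) // cell_key_ltE /=.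
have := sortedP 0 sortedw p pw; rewrite leq_eqVlt => /orP[/eqP eqw|->//].
rewrite eqw ltnn eqxx /=; apply/negPn/negP => ndesc.
have := allP incrw p.+1; rewrite mem_descents (perm_size Sw) size_iota pw ndesc.
by rewrite /= eqw ltnn => /(_ isT).
Qed.

Let sorted_keys_destandardize : sorted_keys (destandardize w S) = relabelled.
Proof.
apply: le_sorted_eq; first exact: sort_le_sorted.
  by have := sorted_relabelled; rewrite lt_sorted_uniq_le => /andP[].
rewrite perm_sort cell_keys_map_cells cell_keysE // -map_comp.
exact: perm_map Sw.
Qed.

Lemma uniq_cell_keys_destandardize : uniq (cell_keys (destandardize w S)).
Proof. by rewrite -lt_sorted_sorted_keys sorted_keys_destandardize. Qed.

Lemma destandardizeK : standardize (destandardize w S) = S.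
Proof.
rewrite /standardize /rank sorted_keys_destandardize map_cells_comp.
apply: map_cells_id_in => -[p k] pk /=; rewrite -(column_cell_keys uniqS pk).
have : p \in flatten S by rewrite -unzip1_cell_keys; apply/mapP; exists (p, k).
rewrite (perm_mem Sw) mem_iota; case: p {pk} => // p /= pw.
by rewrite -nth_relabelled // index_uniq ?size_map ?size_iota ?lt_sorted_uniq.
Qed.

End Destandardize.

Lemma positive_entries_flatten (T : filling) :
  positive_entries T = all (leq 1) (flatten T).
Proof. by elim: T => //= r T IHT; rewrite all_cat -IHT. Qed.

Lemma standardize_fiberP (a w : seq nat) (S T : filling) :
  sorted leq w -> standard_ComT a S ->
  [/\ ComT a T, standardize T = S & perm_eq (flatten T) w] <->
  [&& all (leq 1) w, size w == size (flatten S)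
    & increases_at w (descents S)] /\
  T = destandardize w S.
Proof.
move=> sortedw [comS Sa]; rewrite (perm_size Sa) size_iota.
split=> [[comT TS Tw]|[/and3P[posw /eqP sizew incrw] ->]].
  have [Ta posT _ _ _] := comT; rewrite -TS standardizeK //; split=> //.
  rewrite -(perm_all _ Tw) -positive_entries_flatten posT.
  rewrite -(perm_size Tw) size_flatten Ta eqxx.
  apply: increases_at_descents_standardize => //.
  exact: ComT_uniq_cell_keys comT.
rewrite -sizew in Sa; have Sw := flatten_destandardize Sa.
split; rewrite ?destandardizeK //; apply/ComT_standardize.
- by rewrite positive_entries_flatten (perm_all _ Sw).
- exact: uniq_cell_keys_destandardize.
- by rewrite destandardizeK.
Qed.

(** * Coefficients of fundamental quasisymmetric functions *)

Definition partial_sums (s : seq nat) : seq nat := scanl addn 0 s.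

Lemma foldl_addn (x : nat) (s : seq nat) : foldl addn x s = x + sumn s.
Proof. by elim: s x => [|y s IHs] x /=; rewrite ?addn0 // IHs addnA. Qed.

Lemma scanl_addn (x : nat) (s : seq nat) :
  scanl addn x s = [seq x + y | y <- partial_sums s].
Proof.
rewrite /partial_sums; elim: s x => //= y s IHs x.
rewrite add0n IHs [in RHS](IHs y) -map_comp.
by congr cons; apply: eq_map => z /=; rewrite addnA.
Qed.

Lemma partial_sums_cons (x : nat) (s : seq nat) :
  partial_sums (x :: s) = x :: [seq x + y | y <- partial_sums s].
Proof. by rewrite {1}/partial_sums /= add0n scanl_addn. Qed.

Lemma partial_sums_cat (s t : seq nat) :
  partial_sums (s ++ t) =
  partial_sums s ++ [seq sumn s + y | y <- partial_sums t].
Proof.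
by rewrite {1}/partial_sums scanl_cat foldl_addn add0n (scanl_addn (sumn s)).
Qed.

Lemma leq_partial_sums (s : seq nat) (y : nat) :
  y \in partial_sums s -> y <= sumn s.
Proof.
elim: s y => // x s IHs y; rewrite partial_sums_cons in_cons => /orP[/eqP->|].
  exact: leq_addr.
by move=> /mapP[z /IHs zs ->]; rewrite /= leq_add2l.
Qed.

Lemma partial_sums_gt0 (s : seq nat) (y : nat) :
  is_composition s -> y \in partial_sums s -> 0 < y.
Proof.
case: s => // x s /andP[x0 _].
rewrite partial_sums_cons in_cons => /orP[/eqP->//|].
by move=> /mapP[z _ ->]; rewrite addn_gt0 x0.
Qed.

Lemma sumn_partial_sums (s : seq nat) : s != [::] -> sumn s \in partial_sums s.
Proof.
case/lastP: s => // s x _.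
by rewrite /partial_sums scanl_rcons foldl_addn add0n mem_rcons mem_head.
Qed.

Lemma partial_sums_coarsening (a b : seq nat) :
  coarsening a b -> {subset partial_sums a <= partial_sums b}.
Proof.
move=> [bs [bs0 <- <-]] {a b}.
elim: bs bs0 => // s bs IHbs; rewrite in_cons negb_or eq_sym => /andP[s0 bs0] y.
rewrite [map _ _]/= partial_sums_cons [flatten _]/= partial_sums_cat.
rewrite in_cons mem_cat => /orP[/eqP ->|]; first by rewrite sumn_partial_sums.
by move=> /mapP[z /(IHbs bs0) zbs ->]; rewrite map_f ?orbT.
Qed.

Lemma coarsening_partial_sums (a b : seq nat) : is_composition a ->
  is_composition b -> sumn a = sumn b ->
  {subset partial_sums a <= partial_sums b} -> coarsening a b.
Proof.
elim: a b => [|x a IHa] b /=.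
  move=> _ compb sumb _; exists [::]; split=> //.
  by case: b compb sumb => //= -[].
move=> /andP[x0 compa] compb sumab sub.
have := sub x; rewrite partial_sums_cons mem_head => /(_ isT).
move=> /(nthP 0)[k]; rewrite size_scanl => kb.
rewrite nth_scanl // foldl_addn add0n => sum_take.
rewrite -(cat_take_drop k.+1 b) sumn_cat sum_take in sumab *.
have [||y ya|bs [bs0 bs_flat bs_sum]] := IHa (drop k.+1 b) compa.
- by apply/allP => y /mem_drop /(allP compb).
- exact: addnI sumab.
- have := sub (x + y); rewrite partial_sums_cons in_cons (map_f _ ya) orbT.
  move=> /(_ isT); rewrite -{1}(cat_take_drop k.+1 b) partial_sums_cat mem_cat.
  rewrite sum_take => /orP[/leq_partial_sums|].
    have y0 := partial_sums_gt0 compa ya.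
    by rewrite sum_take -{2}(addn0 x) leq_add2l leqNgt y0.
  by move=> /mapP[z zb /addnI ->].
exists (take k.+1 b :: bs); split; rewrite /= ?sum_take ?bs_flat ?bs_sum //.
rewrite in_cons negb_or bs0 andbT eq_sym -size_eq0 size_take; case: ifP => //.
by move=> /negbT; case: (b) kb.
Qed.

Lemma coarseningP (a b : seq nat) : is_composition a -> is_composition b ->
  coarsening a b <->
  sumn a = sumn b /\ {subset partial_sums a <= partial_sums b}.
Proof.
move=> compa compb; split=> [coarse|[sumab sub]]; last first.
  exact: coarsening_partial_sums.
split; last exact: partial_sums_coarsening.
by case: coarse => bs [_ <- <-]; rewrite sumn_flatten.
Qed.

Definition word (i c : seq nat) : seq nat := tally_seq (zip i c).

Lemma word_cons (y q : nat) (i c : seq nat) :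
  word (y :: i) (q :: c) = nseq q y ++ word i c.
Proof. by []. Qed.

Lemma size_word (i c : seq nat) : size i = size c -> size (word i c) = sumn c.
Proof. by move=> ic; rewrite size_tally_seq unzip2_zip // ic. Qed.

Lemma mem_word (i c : seq nat) (x : nat) : x \in word i c -> x \in i.
Proof.
move=> /flattenP[_ /mapP[[y q] yq ->]]; rewrite mem_nseq => /andP[_ /eqP->] /=.
elim: i c yq => [|z i IHi] [|r c] //=; rewrite !in_cons.
by move=> /orP[/eqP[-> _]|/IHi ->]; rewrite ?eqxx ?orbT.
Qed.

Lemma sorted_word (i c : seq nat) : sorted ltn i -> sorted leq (word i c).
Proof.
rewrite (sorted_pairwise ltn_trans) (sorted_pairwise leq_trans).
elim: i c => [|y i IHi] [|q c] //= /andP[yi si].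
rewrite word_cons pairwise_cat IHi // andbT; apply/andP; split.
  apply/allrelP => x z; rewrite mem_nseq => /andP[_ /eqP->] /mem_word zi.
  exact/ltnW/(allP yi).
by elim: q => //= q ->; rewrite all_nseq leqnn orbT.
Qed.

Lemma count_word (i c : seq nat) (x : nat) :
  count_mem x (word i c) = M_term c i x.
Proof.
rewrite /M_term /word /tally_seq; elim: (zip i c) => [|[y q] s IHs] /=.
  by rewrite big_nil mset0E.
rewrite big_cons count_cat IHs msetE2 msetnE count_nseq /= eq_sym.
by case: eqP; rewrite ?mul1n.
Qed.

Lemma mem_partial_sums_word (i c : seq nat) (p : nat) : sorted ltn i ->
  is_composition c -> size i = size c -> 0 < p < sumn c ->
  (p \in partial_sums c) = (nth 0 (word i c) p.-1 < nth 0 (word i c) p).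
Proof.
rewrite (sorted_pairwise ltn_trans).
elim: i c p => [|y i IHi] [|q c] p //=; first by rewrite ltn0 andbF.
move=> /andP[yi si] /andP[q0 cc] [ic] /andP[p0 pqc].
rewrite partial_sums_cons in_cons word_cons !nth_cat !size_nseq.
have [pq|qp|epq] := ltngtP p q.
- have pq' := leq_ltn_trans (leq_pred p) pq.
  rewrite pq' !nth_nseq pq pq' ltnn; apply/negbTE/mapP => -[z _ ez].
  by rewrite ez ltnNge leq_addr in pq.
- have -> : (p.-1 < q) = false by lia.
  have -> : p.-1 - q = (p - q).-1 by lia.
  rewrite -IHi //; last by lia.
  by rewrite -{1}(subnKC (ltnW qp)) mem_map //; apply: addnI.
- apply/esym; subst p.
  rewrite subnn prednK // leqnn nth_nseq prednK // leqnn /=.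
  have : 0 < size (word i c) by rewrite size_word //; lia.
  by move=> /(mem_nth 0) /mem_word; apply: (allP yi).
Qed.

Definition variables (m : monomial) : seq nat := sort leq (undup m).

Definition exponents (m : monomial) : seq nat := [seq m x | x <- variables m].

Lemma mem_variables (m : monomial) (x : nat) : (x \in variables m) = (x \in m).
Proof. by rewrite mem_sort mem_undup. Qed.

Lemma sorted_variables (m : monomial) : sorted ltn (variables m).
Proof.
rewrite ltn_sorted_uniq_leq sort_uniq undup_uniq.
exact: sort_sorted leq_total _.
Qed.

Lemma exponents_composition (m : monomial) : is_composition (exponents m).
Proof. by apply/allP => _ /mapP[x xm ->]; rewrite -in_mset -mem_variables. Qed.

Lemma M_term_index (c i : seq nat) (x : nat) : size i = size c -> uniq i ->
  M_term c i x = nth 0 c (index x i).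
Proof.
rewrite /M_term; elim: i c => [|y i IHi] [|q c] //=.
  by rewrite big_nil mset0E.
move=> [ic] /andP[yi ui]; rewrite big_cons msetE2 msetnE IHi // eq_sym.
case: eqP => [<-|//]; rewrite nth_default ?addn0 //.
by rewrite -ic memNindex.
Qed.

Lemma M_term_exponents (m : monomial) : M_term (exponents m) (variables m) = m.
Proof.
have us : uniq (variables m) by rewrite sort_uniq undup_uniq.
apply/msetP => x; rewrite M_term_index ?size_map //.
have [xm|xm] := boolP (x \in variables m).
  by rewrite (nth_map 0) ?index_mem // nth_index.
rewrite nth_default ?size_map ?memNindex //.
by apply/esym/mset_eq0P; rewrite -mem_variables.
Qed.

Lemma M_termK (c i : seq nat) : is_composition c -> size i = size c ->
  sorted ltn i -> i = variables (M_term c i) /\ c = exponents (M_term c i).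
Proof.
move=> cc ic si; have ui := sorted_uniq ltn_trans ltnn si.
have iE : i = variables (M_term c i).
  apply: (irr_sorted_eq ltn_trans ltnn) => // [|x].
    exact: sorted_variables.
  rewrite mem_variables in_mset M_term_index // -index_mem ic.
  have [ci|ic'] := leqP (size c) (index x i); first by rewrite nth_default.
  by apply/esym/(allP cc)/mem_nth.
split=> //; rewrite /exponents -iE.
apply: (@eq_from_nth _ 0); rewrite ?size_map // => k kc.
by rewrite (nth_map 0) ?ic // M_term_index // index_uniq ?ic.
Qed.

Lemma sort_word (m : monomial) : sort leq m = word (variables m) (exponents m).
Proof.
apply: (sorted_eq leq_trans anti_leq); first exact/sort_sorted/leq_total.
  exact/sorted_word/sorted_variables.
rewrite perm_sort; apply/allP => x _ /=.
by rewrite count_word M_term_exponents count_mem_mset.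
Qed.

Lemma sumn_exponents (m : monomial) : sumn (exponents m) = size m.
Proof. by rewrite -(size_sort leq) sort_word size_word // size_map. Qed.

Lemma qsym_M_coef (c : seq nat) (m : monomial) : is_composition c ->
  qsym_M c m = (all (leq 1) (variables m) && (c == exponents m))%:R%R.
Proof.
move=> cc; have [/andP[m0 /eqP cE]|ncm] := boolP (_ && _); last first.
  apply: fsbig1 => i [ic i0 si]; rewrite /mono; case: eqP => // mE.
  have [iE cE] := M_termK cc ic si; case/negP: ncm.
  by rewrite mE -cE -iE i0 eqxx.
rewrite /qsym_M /psum -(@fsbig_widen _ _ _ _ [set variables m]).
- by rewrite fsbig_set1 cE /mono M_term_exponents eqxx.
- by move=> _ ->; split; rewrite ?sorted_variables ?cE ?size_map.
- move=> i [[ic _ si] /= ni]; rewrite /mono; case: eqP => // mE; case: ni.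
  by rewrite mE; case: (M_termK cc ic si).
Qed.

Lemma qsym_F_coef (b : seq nat) (m : monomial) :
  qsym_F b m =
  (all (leq 1) (variables m) && `[< coarsening b (exponents m) >])%:R%R.
Proof.
have compm := exponents_composition m.
have [/asboolP bm|/asboolP nbm] := boolP `[< _ >]; last first.
  rewrite andbF; apply: fsbig1 => c [compc bc]; rewrite qsym_M_coef //.
  case: eqP => [cE|_]; last by rewrite andbF.
  by rewrite -cE in nbm.
rewrite andbT /qsym_F /psum -(@fsbig_widen _ _ _ _ [set exponents m]).
- by rewrite fsbig_set1 qsym_M_coef // eqxx andbT.
- by move=> _ ->.
- by move=> c [[compc _] /= /eqP/negPf nc]; rewrite qsym_M_coef // nc andbF.
Qed.

Lemma scanl_pairmap_subn (x : nat) (s : seq nat) : path ltn x s ->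
  scanl addn x (pairmap (fun y z => z - y) x s) = s.
Proof.
by elim: s x => //= y s IHs x /andP[xy ys]; rewrite subnKC ?IHs // ltnW.
Qed.

Lemma sumn_pairmap_subn (x : nat) (s : seq nat) : path ltn x s ->
  x + sumn (pairmap (fun y z => z - y) x s) = last x s.
Proof.
elim: s x => [|y s IHs] x /=; first by rewrite addn0.
by move=> /andP[xy /IHs <-]; rewrite addnA subnKC // ltnW.
Qed.

Lemma pairmap_subn_composition (x : nat) (s : seq nat) : path ltn x s ->
  is_composition (pairmap (fun y z => z - y) x s).
Proof.
by elim: s x => //= y s IHs x /andP[xy /IHs ->]; rewrite subn_gt0 xy.
Qed.

Lemma path_descents (T : filling) : 0 < size (flatten T) ->
  path ltn 0 (rcons (descents T) (size (flatten T))).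
Proof.
move=> T0; rewrite (path_sortedE ltn_trans) all_rcons T0 /=; apply/andP; split.
  by apply/allP => p; rewrite mem_descents => /andP[/andP[]].
rewrite (sorted_pairwise ltn_trans) -cats1 pairwise_cat allrel1r /= andbT.
rewrite -(sorted_pairwise ltn_trans) (sorted_filter ltn_trans) //=; last first.
  exact: iota_ltn_sorted.
rewrite andbT.
by apply/allP => p; rewrite mem_descents => /andP[/andP[]].
Qed.

Lemma descent_composition_composition (T : filling) :
  is_composition (descent_composition T).
Proof.
rewrite /descent_composition /beta; case: posnP => // T0.
exact/pairmap_subn_composition/path_descents.
Qed.

Lemma partial_sums_descent_composition (T : filling) : 0 < size (flatten T) ->
  partial_sums (descent_composition T) = rcons (descents T) (size (flatten T)).
Proof.
move=> T0; rewrite /descent_composition /beta gtn_eqF //.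
exact/scanl_pairmap_subn/path_descents.
Qed.

Lemma sumn_descent_composition (T : filling) :
  sumn (descent_composition T) = size (flatten T).
Proof.
rewrite /descent_composition /beta; case: posnP => // T0.
by rewrite -[sumn _]add0n sumn_pairmap_subn ?path_descents // last_rcons.
Qed.

Lemma coarsening_descent_composition (T : filling) (m : monomial) :
  coarsening (descent_composition T) (exponents m) <->
  size (flatten T) = size m /\ increases_at (sort leq m) (descents T).
Proof.
rewrite coarseningP ?exponents_composition ?descent_composition_composition //.
rewrite sumn_exponents sumn_descent_composition.
have [T0|T0] := posnP (size (flatten T)).
  by rewrite /increases_at /descents /descent_composition T0; split=> -[].
have ascentE p : size (flatten T) = size m -> p \in descents T ->
    (p \in partial_sums (exponents m)) =
    (nth 0 (sort leq m) p.-1 < nth 0 (sort leq m) p).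
  rewrite mem_descents sort_word => Tm /andP[pT _].
  apply: mem_partial_sums_word;
    rewrite ?sorted_variables ?exponents_composition ?size_map //.
  by rewrite sumn_exponents -Tm.
rewrite partial_sums_descent_composition //.
split=> -[Tm sub]; split=> //.
  by apply/allP => p pT; rewrite -ascentE // sub // mem_rcons in_cons pT orbT.
move=> p; rewrite mem_rcons in_cons => /orP[/eqP->|pT].
  rewrite Tm -sumn_exponents sumn_partial_sums //.
  apply: contraTneq T0 => expm0.
  by rewrite Tm -sumn_exponents expm0.
by rewrite ascentE //; apply: (allP sub).
Qed.

Lemma qsym_F_descents_coef (T : filling) (m : monomial) (w := sort leq m) :
  qsym_F (descent_composition T) m =
  [&& all (leq 1) w, size w == size (flatten T)
    & increases_at w (descents T)]%:R%R.
Proof.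
rewrite qsym_F_coef /variables /w !all_sort all_undup.
congr (_ && _)%:R%R; apply: (asbool_equiv_eqP andP).
by rewrite coarsening_descent_composition size_sort eq_sym (rwP eqP).
Qed.

(** * Content generating functions *)

Definition content_gf (X : set filling) : fps :=
  psum X (fun T => mono (content T)).

Lemma summable_mono_content (X : set filling) :
  (forall m, finite_set (X `&` [set T | perm_eq (flatten T) m])) ->
  summable X (fun T => mono (content T)).
Proof.
move=> finX m; apply: sub_finite_set (finX m) => T [XT /mono_neq0 mT].
by split=> //; apply: content_perm.
Qed.

Lemma summable_SSAFs (a : seq nat) :
  summable (SSAFs a) (fun T => mono (content T)).
Proof.
apply: summable_mono_content => m.
apply: sub_finite_set (finite_fillings m (finite_expansions a m)).
by move=> T [/SSAFsP[aT ssafT] Tm]; split=> //; split=> //; exists T.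
Qed.

Lemma finite_ComT_perm (a s : seq nat) :
  finite_set (ComT a `&` [set T | perm_eq (flatten T) s]).
Proof.
by apply: sub_finite_set (finite_fillings s (finite_set1 a)) => T [[]].
Qed.

Lemma summable_ComT (a : seq nat) :
  summable (ComT a) (fun T => mono (content T)).
Proof. by apply: summable_mono_content => m; apply: finite_ComT_perm. Qed.

Lemma quasi_schur_content_gf (a : seq nat) :
  quasi_schur a = content_gf (SSAFs a).
Proof.
rewrite /content_gf -(@psum_fiber _ _ _ (expansion a) shape); last 2 first.
- exact: summable_SSAFs.
- by move=> T /SSAFsP[].
apply: eq_psum => g ag; rewrite /dem_atom; congr psum; apply/seteqP; split=> T.
  by move=> ssafT; split; [exists g|apply: SSAF_shape ssafT].
by case=> /SSAFsP[_ ssafT] <-.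
Qed.

Lemma content_gf_SSAFs (a : seq nat) : is_composition a ->
  content_gf (SSAFs a) = content_gf (ComT a).
Proof.
move=> compa; rewrite /content_gf (psum_set_bij _ (set_bij_drop_empty compa)).
by apply: eq_psum => T _ /=; rewrite content_drop_empty.
Qed.

Lemma content_eq_sort (T : filling) (m : monomial) :
  m = content T <-> perm_eq (flatten T) (sort leq m).
Proof.
rewrite perm_sym perm_sort perm_sym; split; first exact: content_perm.
by move=> Tm; rewrite -[m]seq_mset_id; apply/esym/eq_seq_msetP.
Qed.

Lemma content_gf_standardize (a : seq nat) (S : filling) : standard_ComT a S ->
  content_gf (ComT a `&` standardize @^-1` [set S]) =
  qsym_F (descent_composition S).
Proof.
move=> stdS; apply/funext => m; rewrite qsym_F_descents_coef.
set w := sort leq m; have sortedw : sorted leq w by apply/sort_sorted/leq_total.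
have fiberP T := standardize_fiberP T sortedw stdS.
have [incrw|nincrw] := boolP [&& _, _ & _]; last first.
  apply: fsbig1 => T [comT TS].
  rewrite /mono; case: eqP => // /content_eq_sort Tw.
  by case/negP: nincrw; have [] := (fiberP T).1 (And3 comT TS Tw).
have [comT TS Tw] := (fiberP (destandardize w S)).2 (conj incrw erefl).
rewrite /content_gf /psum -(@fsbig_widen _ _ _ _ [set destandardize w S]).
- by rewrite fsbig_set1 /mono -((content_eq_sort _ _).2 Tw) eqxx.
- by move=> _ ->.
- move=> T [[comT' TS'] /= neqT].
  rewrite /mono; case: eqP => // /content_eq_sort Tw'.
  by case: neqT; have [] := (fiberP T).1 (And3 comT' TS' Tw').
Qed.

Lemma standard_ComT_standardize (a : seq nat) (T : filling) :
  ComT a T -> standard_ComT a (standardize T).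
Proof.
move=> comT; have uT := ComT_uniq_cell_keys comT; have [Ta posT _ _ _] := comT.
split; first exact/ComT_standardize.
by rewrite -Ta -size_flatten flatten_standardize.
Qed.

Lemma content_gf_ComT (a : seq nat) :
  content_gf (ComT a) =
  psum (standard_ComT a) (fun S => qsym_F (descent_composition S)).
Proof.
rewrite /content_gf -(@psum_fiber _ _ _ (standard_ComT a) standardize);
  last 2 first.
- exact: summable_ComT.
- exact: standard_ComT_standardize.
by apply: eq_psum => S /content_gf_standardize <-.
Qed.

Lemma psum_standard_ComT (a : seq nat) :
  psum (standard_ComT a) (fun S => qsym_F (descent_composition S)) =
  psum composition_set (fun b => qsym_F b *+ d_ComT a b)%R.
Proof.
rewrite -(@psum_fiber _ _ _ composition_set descent_composition); last 2 first.
- have fin := finite_ComT_perm a (iota 1 (sumn a)).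
  by move=> m; apply: sub_finite_set fin => S [].
- by move=> S _; apply: descent_composition_composition.
apply: eq_psum => b _; rewrite -psum_const; last exact: finite_d_ComT_set.
by apply: eq_psum => S [_ /= ->].
Qed.

Lemma d_SAF_setP (a b : seq nat) (T : filling) :
  d_SAF_set a b T <-> [/\ SSAFs a T, perm_eq (flatten T) (iota 1 (sumn a))
                        & descent_composition T = b].
Proof.
split=> [[[g ag [ssafT cT]] Tb]|[[g ag ssafT] Ta Tb]].
  split=> //; first by exists g.
  by case: ag => _ <-; rewrite sumn_compress; apply/eq_seq_msetP.
split=> //; exists g => //; split=> //; apply/eq_seq_msetP.
by rewrite -sumn_compress; case: ag => _ ->.
Qed.

Lemma d_ComT_set_drop_empty (a b : seq nat) : is_composition a ->
  d_ComT_set a b = drop_empty @` d_SAF_set a b.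
Proof.
move=> compa; have [dropE _ dropS] := set_bij_drop_empty compa.
apply/seteqP; split=> [U [[comU Ua] Ub]|_ [T /d_SAF_setP[ssafT Ta Tb] <-]].
  have [T ssafT TU] := dropS U comU; exists T => //; apply/d_SAF_setP.
  by rewrite -flatten_drop_empty -descent_composition_drop_empty TU.
split; last by rewrite descent_composition_drop_empty.
by split; [apply: dropE|rewrite flatten_drop_empty].
Qed.

Lemma d_SAF_d_ComT (a b : seq nat) : is_composition a -> d_SAF a b = d_ComT a b.
Proof.
move=> compa; have finSAF := finite_d_SAF_set a b.
rewrite /d_ComT d_ComT_set_drop_empty // fset_set_image //.
rewrite card_in_imfset //= => T U.
rewrite !in_fset_set // !inE => /d_SAF_setP[ssafT _ _] /d_SAF_setP[ssafU _ _].
have [_ dropI _] := set_bij_drop_empty compa.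
by apply: dropI; rewrite inE.
Qed.

Local Open Scope ring_scope.

Theorem theorem6p2 (a : seq nat) (ha : is_composition a) :
  quasi_schur a = psum composition_set (fun b => qsym_F b *+ d_SAF a b) /\
  (forall b : seq nat, is_composition b -> d_SAF a b = d_ComT a b).
Proof.
split=> [|b _]; last exact: d_SAF_d_ComT.
rewrite quasi_schur_content_gf content_gf_SSAFs // content_gf_ComT.
by rewrite psum_standard_ComT; apply: eq_psum => b _; rewrite d_SAF_d_ComT.
Qed.
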